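(* Let $\mathbb{T}$ be a time scale, $a,b\in\mathbb{T}$ with $a<b$, $B\in\mathbb{R}$, and let $\varphi:[a,b]^\kappa_{\mathbb{T}}\to\mathbb{R}$ be a positive and rd-continuous function such that $$\frac{B+\int_a^b\varphi(s)\Delta s}{b-a}>\varphi(t),\quad t\in[a,b]^\kappa_{\mathbb{T}}.$$ Then, among all $C^1_{\mathrm{rd}}$ functions $y:[a,b]_{\mathbb{T}}\to\mathbb{R}$ satisfying $y^\Delta>0$, $y(a)=0$ and $y(b)=B$, the functional $$F[y(\cdot)]=\int_a^b[\varphi(t)+y^\Delta(t)]\ln[\varphi(t)+y^\Delta(t)]\Delta t$$ has minimum value $F_{\min}=(b-a)C\ln(C)$ attained when $$y(t)=C(t-a)-\int_a^t\varphi(s)\Delta s,\quad t\in[a,b]_{\mathbb{T}},$$ where $$C=\frac{B+\int_a^b\varphi(s)\Delta s}{b-a}.$$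
   Context: A time scale is a nonempty closed subset of $\mathbb{R}$; $[a,b]_{\mathbb{T}}=[a,b]\cap\mathbb{T}$, and $[a,b]^\kappa_{\mathbb{T}}$ is $[a,b]_{\mathbb{T}}$ without $b$ if $b$ is left-scattered ($\rho(b)<b$), and $[a,b]_{\mathbb{T}}$ otherwise. $\sigma(t)=\inf\{s\in\mathbb{T}:s>t\}$, $\rho(t)=\sup\{s\in\mathbb{T}:s<t\}$. $f^\Delta(t)$ is the $\Delta$-derivative: for each $\varepsilon>0$, $|f(\sigma(t))-f(s)-f^\Delta(t)(\sigma(t)-s)|\le\varepsilon|\sigma(t)-s|$ for $s$ in a neighborhood of $t$. A function is rd-continuous if it is continuous at right-dense points ($\sigma(t)=t$) and has finite left limits at left-dense points ($\rho(t)=t$). $C^1_{\mathrm{rd}}$: $\Delta$-differentiable with rd-continuous $\Delta$-derivative. $\int_a^b f\Delta t=F(b)-F(a)$ with $F^\Delta=f$. *)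

(* Defs.v *)
From HB Require Import structures.
From mathcomp Require Import all_boot all_order all_algebra.
From mathcomp Require Import all_classical all_reals all_analysis.
Import Order.TTheory GRing.Theory Num.Theory.
Import numFieldNormedType.Exports.

Set Implicit Arguments.
Unset Strict Implicit.
Unset Printing Implicit Defensive.

Local Open Scope classical_set_scope.
Local Open Scope ring_scope.

(* Functions on a subset of the line are represented by total functions
   [R -> R]; every notion below only looks at their values on that subset. *)

Definition time_scale (R : realType) (T : set R) : Prop :=
  T !=set0 /\ closed T.

(* The usual conventions inf set0 = sup T and sup set0 = inf T are made
   explicit, so that sigma fixes max T and rho fixes min T (the library's
   [inf set0] and [sup set0] are 0). *)
Definition sigma (R : realType) (T : set R) (t : R) : R :=
  if `[< exists2 s, T s & t < s >] then inf [set s | T s /\ t < s] else sup T.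

Definition rho (R : realType) (T : set R) (t : R) : R :=
  if `[< exists2 s, T s & s < t >] then sup [set s | T s /\ s < t] else inf T.

Definition ts_itv (R : realType) (T : set R) (a b : R) : set R :=
  T `&` [set t | a <= t <= b].

Definition ts_itvk (R : realType) (T : set R) (a b : R) : set R :=
  if rho T b < b then ts_itv T a b `\ b else ts_itv T a b.

Definition is_delta_derive (R : realType) (T : set R) (f : R -> R) (t d : R) :
    Prop :=
  forall e : R, 0 < e -> \forall s \near within T (nbhs t),
    `|f (sigma T t) - f s - d * (sigma T t - s)| <= e * `|sigma T t - s|.

(* The value 0 is used where [f] is not delta-differentiable. *)
Definition delta_derive (R : realType) (T : set R) (f : R -> R) (t : R) : R :=
  xget 0 [set d | is_delta_derive T f t d].

(* Rd-continuity of [f : D -> R], where [D] is a subset of the time scale [T]: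
   the density of a point is decided in [T], the limits are taken within [D].
   (They differ at rho b, right-scattered in [a, b] although it is the maximum
   of [a, b]^kappa when b is left-scattered.)  The left limit is a vacuous
   requirement at min T. *)
Definition rd_continuous (R : realType) (T D : set R) (f : R -> R) : Prop :=
  forall t, D t ->
    (sigma T t = t -> f s @[s --> within D (nbhs t)] --> f t) /\
    (rho T t = t -> exists l : R, f s @[s --> within D (t^'-)] --> l).

(* Functions on [a, b]_T are differentiated, and their rd-continuity is tested,
   with respect to the time scale [a, b]_T.  This agrees with T except at the
   end points: for instance if b is left-dense and right-scattered in T, a
   function on [a, b]_T has no value at sigma T b, so that its derivative at b
   only makes sense with b as the last point of the time scale. *)
Definition C1rd (R : realType) (T : set R) (a b : R) (y : R -> R) : Prop :=
  (forall t, ts_itvk T a b t ->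
     exists d, is_delta_derive (ts_itv T a b) y t d) /\
  rd_continuous (ts_itv T a b) (ts_itvk T a b)
    (delta_derive (ts_itv T a b) y).

Definition delta_antiderivative (R : realType) (T : set R) (a b : R)
    (f F : R -> R) : Prop :=
  forall t, ts_itvk T a b t -> is_delta_derive (ts_itv T a b) F t (f t).

(* The integral of [f] from c to d, for c and d in [a, b]_T, by means of an
   antiderivative on the whole of [a, b]_T; it is 0 if there is none. *)
Definition delta_integral (R : realType) (T : set R) (a b : R) (f : R -> R)
    (c d : R) : R :=
  let F := xget (fun=> 0) [set F | delta_antiderivative T a b f F] in
  F d - F c.

Definition admissible (R : realType) (T : set R) (a b B : R) (y : R -> R) :
    Prop :=
  [/\ C1rd T a b y,
      forall t, ts_itvk T a b t -> 0 < delta_derive (ts_itv T a b) y t,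
      y a = 0 & y b = B].

Definition entropy_functional (R : realType) (T : set R) (a b : R)
    (phi y : R -> R) : R :=
  let yD := delta_derive (ts_itv T a b) y in
  delta_integral T a b (fun t => (phi t + yD t) * ln (phi t + yD t)) a b.

(* Main.v *)
Require Import Defs.
From HB Require Import structures.
From mathcomp Require Import all_boot all_order all_algebra.
From mathcomp Require Import all_classical all_reals all_analysis.
From mathcomp Require Import ring lra.
Import Order.TTheory GRing.Theory Num.Theory.
Import numFieldNormedType.Exports.

(** The proof is convexity of x ln x.  Put u := phi + y^Delta > 0.  The tangent
line of x ln x at C gives
    u ln u >= C ln C + (ln C + 1) (u - C)        ([xlnx_tangent]),
with equality when u = C.  By the boundary conditions the Delta-integral of u
over [a, b] is B plus that of phi, that is, C (b - a) for every admissible y.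
The linear term therefore integrates to 0 and the lower bound (b - a) C ln C
follows.  The candidate y is the solution of u = C, for which the integrand is
constant; y^Delta = C - phi > 0 is the hypothesis on phi.

Two facts of the calculus on time scales carry this argument.

- Comparison ([delta_antiderivative_le]): if f <= g, then the antiderivatives
  satisfy F(b) - F(a) <= G(b) - G(a).  In particular an integral does not depend
  on the antiderivative chosen to compute it.

- Existence ([upper_integral_delta_antiderivative]): a bounded function that is
  continuous at the right-dense points has an antiderivative.  It is obtained as
  an upper Darboux integral: F is the largest function vanishing at a whose
  increments satisfy F(d) - F(c) <= M (d - c) whenever f <= M on [c, d).  By
  maximality it also satisfies the reverse estimate for lower bounds of f
  ([upper_integral_ge]), and these two estimates yield F^Delta = f.

Rd-continuous functions are bounded by compactness of [a, b]_T
([rd_continuous_bounded]), so existence applies to phi.  The integrand u ln u of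
an admissible y needs more care: u may have the left limit 0, at which ln is
not continuous.  Existence only asks for a bound, and x - 1 <= x ln x <= x (x - 1)
provides one ([xlnx_bounds]). *)

Set Implicit Arguments.
Unset Strict Implicit.
Unset Printing Implicit Defensive.

Local Open Scope classical_set_scope.
Local Open Scope ring_scope.

Lemma near_within_distP (R : realType) (S : set R) (t : R) (P : R -> Prop) :
  (\forall s \near within S (nbhs t), P s) <->
  exists2 e : R, 0 < e & forall s, S s -> `|t - s| < e -> P s.
Proof.
rewrite near_withinE; split.
  move=> /nbhs_ballP[e /= e0 He]; exists e => // s Ss ts.
  exact: (He s ts Ss).
move=> [e e0 He]; apply/nbhs_ballP; exists e => //= s ts Ss; exact: He.
Qed.

(** * Delta-derivatives *)

Section DeltaDerivative.
Variables (R : realType) (S : set R).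
Implicit Types (f g : R -> R) (t p q : R).

(** Taking s = t in the definition leaves an error e |sigma t - t| for every e,
hence no error at all. *)
Lemma delta_derive_sigma f t p :
  S t -> is_delta_derive S f t p ->
  f (sigma S t) = f t + p * (sigma S t - t).
Proof.
move=> St fp; set u := sigma S t.
suff : `|f u - (f t + p * (u - t))| <= 0 by rewrite normr_le0 subr_eq0 => /eqP.
apply/ler_addgt0Pr => e e0; rewrite add0r.
set k := e / (`|u - t| + 1).
have p1 : 0 < `|u - t| + 1 by rewrite ltr_wpDl.
have k0 : 0 < k by rewrite divr_gt0.
have /near_within_distP[r r0 /(_ t St)] := fp k k0.
rewrite subrr normr0 => /(_ r0); rewrite -/u opprD addrA => /le_trans; apply.
rewrite /k mulrAC ler_pdivrMr // ler_pM2l //; lra.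
Qed.

Lemma is_delta_deriveD f g t p q :
  is_delta_derive S f t p -> is_delta_derive S g t q ->
  is_delta_derive S (fun s => f s + g s) t (p + q).
Proof.
move=> fp gq e e0; have e2 : 0 < e / 2 by rewrite divr_gt0.
near=> s.
rewrite (_ : _ - _ = (f (sigma S t) - f s - p * (sigma S t - s))
  + (g (sigma S t) - g s - q * (sigma S t - s))); last lra.
apply: le_trans (ler_normD _ _) _.
rewrite (_ : e * _ = e / 2 * `|sigma S t - s| + e / 2 * `|sigma S t - s|);
  last by rewrite -mulrDl -splitr.
by apply: lerD; near: s; [exact: fp|exact: gq].
Unshelve. all: by end_near. Qed.

Lemma is_delta_deriveZ f t c p :
  is_delta_derive S f t p -> is_delta_derive S (fun s => c * f s) t (c * p).
Proof.
move=> fp e e0; have c1 : 0 < `|c| + 1 by rewrite ltr_wpDl.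
have ec : 0 < e / (`|c| + 1) by rewrite divr_gt0.
near=> s.
rewrite (_ : _ - _ = c * (f (sigma S t) - f s - p * (sigma S t - s))); last lra.
rewrite normrM.
have h : `|f (sigma S t) - f s - p * (sigma S t - s)| <=
  e / (`|c| + 1) * `|sigma S t - s| by near: s; exact: fp.
apply: le_trans (ler_wpM2l (normr_ge0 _) h) _.
rewrite mulrA ler_wpM2r // mulrA ler_pdivrMr // mulrC ler_pM2l //; lra.
Unshelve. all: by end_near. Qed.

Lemma is_delta_derive_affine t c k :
  is_delta_derive S (fun s => c * s + k) t c.
Proof.
move=> e e0; near=> s; rewrite (_ : _ - _ = 0); last lra.
by rewrite normr0 mulr_ge0 // ltW.
Unshelve. all: by end_near. Qed.

Lemma is_delta_derive_ext f g t p :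
  (forall s, S s -> f s = g s) -> S (sigma S t) ->
  is_delta_derive S f t p -> is_delta_derive S g t p.
Proof.
move=> fg Su fp e e0; have /near_within_distP[r r0 H] := fp e e0.
apply/near_within_distP; exists r => // s Ss ts.
by rewrite -!fg //; exact: H.
Qed.

End DeltaDerivative.

(** * The time scale of a bounded interval *)

Section TimeScaleInterval.
Variables (R : realType) (T : set R) (a b : R).
Hypotheses (cT : closed T) (Ta : T a) (Tb : T b) (ab : a < b).
Local Notation S := (ts_itv T a b).
Local Notation K := (ts_itvk T a b).
Implicit Types (f g F G : R -> R) (s t e : R).

Lemma ts_itv_bounds t : S t -> a <= t /\ t <= b.
Proof. by move=> [_ /= /andP[]]. Qed.

Lemma ts_itv_left : S a.
Proof. by split=> //=; rewrite lexx ltW. Qed.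

Lemma ts_itv_right : S b.
Proof. by split=> //=; rewrite lexx ltW. Qed.

Lemma ts_itvk_sub t : K t -> S t.
Proof. by rewrite /ts_itvk; case: ifP => _ // -[]. Qed.

Lemma ts_itvk_lt t : S t -> t < b -> K t.
Proof.
rewrite /ts_itvk; case: ifP => _ // St tb; split=> // /= tE.
by rewrite tE ltxx in tb.
Qed.

Lemma closed_ts_itv : closed S.
Proof.
apply: closedI => //.
rewrite (_ : [set t | _] = `[a, b]%classic); first exact: itv_closed.
by apply/seteqP; split=> x /=; rewrite in_itv.
Qed.

Lemma compact_ts_itv : compact S.
Proof.
rewrite /ts_itv setIC.
rewrite (_ : [set t | _] = `[a, b]%classic).
  by apply: compact_closedI => //; exact: segment_compact.
by apply/seteqP; split=> x /=; rewrite in_itv.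
Qed.

Lemma ts_itvk_right_dense e :
  K b -> 0 < e -> exists2 s, S s & b - e < s < b.
Proof.
rewrite /ts_itvk; case: ifPn => [_ [_ /=]//|].
have ne : `[< exists2 s, T s & s < b >] by apply/asboolP; exists a.
rewrite /rho ne -leNgt => br _ e0.
have hs : has_sup [set s | T s /\ s < b].
  by split; [exists a|exists b => s [_ /ltW]].
have m0 : 0 < Num.min e (b - a) by rewrite lt_min e0 subr_gt0.
have [s [Ts sb] /= h] := sup_adherent m0 hs.
have h2 : b - Num.min e (b - a) < s by lra.
have : Num.min e (b - a) <= e by rewrite ge_min lexx.
have : Num.min e (b - a) <= b - a by rewrite ge_min lexx orbT.
by move=> h3 h4; exists s; [split=> //=|]; lra.
Qed.

Lemma ts_itvk_right_isolated :
  ~ K b -> exists2 e, 0 < e & forall s, S s -> `|b - s| < e -> s = b.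
Proof.
rewrite /ts_itvk; case: ifPn => [|_ nb]; last first.
  by exfalso; apply: nb; exact: ts_itv_right.
have ne : `[< exists2 s, T s & s < b >] by apply/asboolP; exists a.
rewrite /rho ne => br _; exists (b - sup [set s | T s /\ s < b]).
  by rewrite subr_gt0.
move=> s Ss bs; have [_ sb] := ts_itv_bounds Ss.
apply/eqP; rewrite eq_le sb leNgt; apply/negP => slt.
have : s <= sup [set s | T s /\ s < b].
  by apply: ub_le_sup; [exists b => u [_ /ltW]|split=> //; case: Ss].
by move: bs; rewrite ger0_norm; lra.
Qed.

Lemma sigma_right : sigma S b = b.
Proof.
rewrite /sigma; case: asboolP => [[s /ts_itv_bounds[_ sb] bs]|_].
  by lra.
have Sb := ts_itv_right.
apply/eqP; rewrite eq_le; apply/andP; split.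
  by apply: ge_sup; [exists b|move=> s /ts_itv_bounds[]].
by apply: ub_le_sup => //; exists b => s /ts_itv_bounds[].
Qed.

Lemma sigmaP t : S t -> t < b ->
  [/\ S (sigma S t), t <= sigma S t & forall s, S s -> t < s -> sigma S t <= s].
Proof.
move=> St tb; have Sb := ts_itv_right.
rewrite /sigma; case: asboolP => [_|n]; last first.
  by exfalso; apply: n; exists b.
set E := [set s | S s /\ t < s].
have hl : has_lbound E by exists t => s [_ /ltW].
have ne : E !=set0 by exists b.
split.
- apply: closed_ts_itv => B /nbhs_ballP[e /= e0 eB].
  have [s [Ss ts] se] := inf_adherent e0 (conj ne hl).
  exists s; split=> //; apply: eB; rewrite /ball /= distrC ger0_norm.
    by rewrite ltrBlDl.
  by rewrite subr_ge0 ge_inf.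
- by apply: lb_le_inf => // s [_ /ltW].
- by move=> s Ss ts; apply: ge_inf.
Qed.

Lemma ts_itv_sigma t : S t -> S (sigma S t) /\ t <= sigma S t.
Proof.
move=> St; have [_] := ts_itv_bounds St.
rewrite le_eqVlt => /predU1P[->|tb]; first by
  rewrite sigma_right; split=> //; exact: ts_itv_right.
by have [] := sigmaP St tb.
Qed.

Lemma right_dense_near t e : S t -> t < b -> sigma S t = t -> 0 < e ->
  exists2 s, S s & t < s < t + e.
Proof.
move=> St tb; have Sb := ts_itv_right.
rewrite /sigma; case: asboolP => [_ tE e0|n]; last first.
  by exfalso; apply: n; exists b.
have hi : has_inf [set s | S s /\ t < s].
  by split; [exists b|exists t => s [_ /ltW]].
have [s [Ss ts] h] := inf_adherent e0 hi.
by exists s => //; move: h; rewrite tE ts.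
Qed.

(** This is what the removal of a left-scattered b is for: [sigma] fixes b by
convention, and without left-density b could be isolated. *)
Lemma ts_itvk_accumulation t e : K t -> sigma S t = t -> 0 < e ->
  exists2 s, S s & s != t /\ `|t - s| < e.
Proof.
move=> Kt tE e0; have St := ts_itvk_sub Kt.
have [_] := ts_itv_bounds St; rewrite le_eqVlt => /predU1P[tb|tb].
  rewrite tb in Kt *; have [s Ss /andP[h1 h2]] := ts_itvk_right_dense Kt e0.
  by exists s => //; split; [rewrite lt_eqF|rewrite gtr0_norm; lra].
have [s Ss /andP[h1 h2]] := right_dense_near St tb tE e0.
by exists s => //; split; [rewrite gt_eqF|rewrite ltr0_norm; lra].
Qed.

(** At a right-scattered point the derivative is the slope of the jump; at any
other point it is a limit of slopes along points s <> t. *)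
Lemma is_delta_derive_unique f t p q :
  K t -> is_delta_derive S f t p -> is_delta_derive S f t q -> p = q.
Proof.
move=> Kt fp fq; have St := ts_itvk_sub Kt.
have [tE|tN] := eqVneq (sigma S t) t; last first.
  have := delta_derive_sigma St fp; rewrite (delta_derive_sigma St fq).
  move/addrI/mulIf => -> //; by rewrite subr_eq0.
apply/eqP; rewrite -subr_eq0 -normr_le0; apply/ler_addgt0Pr => e e0; rewrite add0r.
have e2 : 0 < e / 2 by rewrite divr_gt0.
have /near_within_distP[r r0 H] := fp _ e2.
have /near_within_distP[r' r0' H'] := fq _ e2.
have [|s Ss [st]] := @ts_itvk_accumulation t (Num.min r r') Kt tE.
  by rewrite lt_min r0.
rewrite lt_min => /andP[/(H _ Ss) h /(H' _ Ss) h'].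
have d0 : 0 < `|sigma S t - s| by rewrite normr_gt0 subr_eq0 tE eq_sym.
rewrite -(ler_pM2r d0) -normrM.
rewrite (_ : _ * _ = (f (sigma S t) - f s - q * (sigma S t - s))
   - (f (sigma S t) - f s - p * (sigma S t - s))); last lra.
apply: le_trans (ler_normB _ _) _; lra.
Qed.

Lemma delta_deriveE f t p :
  K t -> is_delta_derive S f t p -> delta_derive S f t = p.
Proof.
move=> Kt fp; apply: xget_unique => // q fq.
exact: (is_delta_derive_unique Kt fq fp).
Qed.

Lemma is_delta_derive_delta_derive f t :
  (exists p, is_delta_derive S f t p) ->
  is_delta_derive S f t (delta_derive S f t).
Proof. exact: xgetPex. Qed.

(** * Comparison of antiderivatives *)

(** Let c be the last point where f is at least f a.  It cannot be less than b:
if c is right-scattered, then f increases at the jump from c to [sigma c], and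
if c is right-dense, then f (s) >= f (c) for the points s > c close to c. *)
Lemma delta_derive_gt0_le f f' :
  (forall t, K t -> is_delta_derive S f t (f' t)) ->
  (forall t, K t -> 0 < f' t) -> f a <= f b.
Proof.
move=> fd f0; pose A := [set t | S t /\ f a <= f t].
have Aa : A a by split => //; exact: ts_itv_left.
have hsA : has_sup A by split; [exists a|exists b => t [/ts_itv_bounds[]]].
set c := sup A.
(* the supremum is attained: unless c = b is isolated, f is differentiable at c,
   hence continuous, and f (s) >= f a along points s of A tending to c *)
have Sc : S c.
  apply: closed_ts_itv; have : closure A c by apply: closure_sup; case: hsA.
  by apply: closure_subset => t [].
have ubc t : A t -> t <= c by move=> At; apply: ub_le_sup => //; case: hsA.
have Kc : ~ A c -> K c.
  move=> nAc; have [_] := ts_itv_bounds Sc.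
  rewrite le_eqVlt => /predU1P[cb|]; last exact: ts_itvk_lt.
  apply: contrapT => nK; rewrite cb in nK.
  have [e e0 He] := ts_itvk_right_isolated nK.
  have [t At tc] := sup_adherent e0 hsA.
  have tlc := ubc t At; case: (At) => St _.
  apply: nAc; rewrite cb -(He t St) //.
  by rewrite ger0_norm -cb; move: tc; rewrite -/c; lra.
have [_ fc] : A c.
  apply: contrapT => nAc; have {}Kc := Kc nAc; apply: nAc; split=> //.
  have [Su cu] := ts_itv_sigma Sc; have [_ ub] := ts_itv_bounds Su.
  have [ac _] := ts_itv_bounds Sc.
  have fu := delta_derive_sigma Sc (fd c Kc).
  have f'0 := f0 c Kc.
  apply/ler_addgt0Pr => e e0.
  have bp : 0 < b - a + 1 by lra.
  have k0 : 0 < e / (b - a + 1) by rewrite divr_gt0.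
  have /near_within_distP[r r0 H] := fd c Kc _ k0.
  have [t At tc] := sup_adherent r0 hsA.
  have tlc := ubc t At; case: (At) => St ft; have [ta _] := ts_itv_bounds St.
  have := H t St; rewrite ger0_norm ?subr_ge0 // => /(_ _).
  rewrite -/c in tc; have cr : c - t < r by lra.
  move=> /(_ cr) /ler_normlP[h1 h2].
  rewrite ger0_norm in h1; last lra.
  have h3 : 0 <= f' c * (c - t) by rewrite mulr_ge0 ?subr_ge0 // ltW.
  have h4 : e / (b - a + 1) * (sigma S c - t) <= e.
    by rewrite mulrAC ler_pdivrMr // ler_pM2l //; lra.
  rewrite fu in h1 h2; lra.
have [_] := ts_itv_bounds Sc; rewrite le_eqVlt => /predU1P[<- //|cb].
have {}Kc := ts_itvk_lt Sc cb; have [Su cu _] := sigmaP Sc cb.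
have [cE|cN] := eqVneq (sigma S c) c; last first.
  have cu' : c < sigma S c by rewrite lt_neqAle eq_sym cN.
  have : sigma S c <= c.
    apply: ubc; split=> //; rewrite (delta_derive_sigma Sc (fd c Kc)).
    by apply: le_trans fc _; rewrite lerDl mulr_ge0 // ?ltW ?f0 // subr_gt0.
  by rewrite leNgt cu'.
have /near_within_distP[r r0 H] := fd c Kc _ (f0 c Kc).
have [s Ss /andP[cs sr]] := right_dense_near Sc cb cE r0.
have : s <= c.
  apply: ubc; split => //; apply: le_trans fc _.
  have := H s Ss; rewrite cE ltr0_norm ?subr_lt0 // => /(_ _).
  have -> : - (c - s) < r by lra.
  by move=> /(_ isT) /ler_normlP[h1 h2]; lra.
by rewrite leNgt cs.
Qed.

(** The difference G - F is tilted by a small slope k to make its derivative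
positive; k = e / (b - a) changes its increment by e. *)
Lemma delta_antiderivative_le f g F G :
  delta_antiderivative T a b f F -> delta_antiderivative T a b g G ->
  (forall t, K t -> f t <= g t) -> F b - F a <= G b - G a.
Proof.
move=> Ff Gg fg; apply/ler_addgt0Pr => e e0.
have ab0 : 0 < b - a by rewrite subr_gt0.
have k0 : 0 < e / (b - a) by rewrite divr_gt0.
set k := e / (b - a) in k0.
have H t : K t -> is_delta_derive S
    (fun s => G s + -1 * F s + (k * s + 0)) t (g t + -1 * f t + k).
  move=> Kt; apply: is_delta_deriveD; last exact: is_delta_derive_affine.
  by apply: is_delta_deriveD; [exact: Gg|apply: is_delta_deriveZ; exact: Ff].
have /(delta_derive_gt0_le H) : forall t, K t -> 0 < g t + -1 * f t + k.
  by move=> t /fg; lra.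
have : k * b = k * a + e by rewrite /k; field; lra.
lra.
Qed.

(** * Existence of antiderivatives *)

(** An upper Riemann sum of f over [c, d] is a sum of terms M (d' - c'), so these
are the functions whose increments are at most the upper Darboux integrals. *)
Definition sup_dominated f (H : R -> R) :=
  H a = 0 /\ forall c d M, S c -> S d -> c <= d ->
    (forall t, S t -> c <= t < d -> f t <= M) -> H d - H c <= M * (d - c).

Definition upper_integral f t := sup [set H t | H in sup_dominated f].

Section UpperIntegral.
Variables (f : R -> R) (L : R).
Hypothesis fL : forall t, K t -> `|f t| <= L.
Let F := upper_integral f.

Let fitv c d t : S c -> S d -> S t -> c <= t < d -> - L <= f t <= L.
Proof.
move=> Sc Sd St /andP[ct td]; have [_ db] := ts_itv_bounds Sd.
by rewrite -ler_norml; apply/fL/ts_itvk_lt => //; lra.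
Qed.

Lemma has_sup_dominated t : S t -> has_sup [set H t | H in sup_dominated f].
Proof.
move=> St; have [ta tb] := ts_itv_bounds St; have Sa := ts_itv_left.
split.
  exists (- L * (t - a)); exists (fun s => - L * (s - a)) => //; split.
    by rewrite subrr mulr0.
  move=> c d M Sc Sd; rewrite le_eqVlt => /predU1P[->|cd] fM.
    by rewrite !subrr mulr0.
  rewrite -mulrBr (_ : d - a - (c - a) = d - c); last lra.
  have cc : c <= c < d by rewrite lexx.
  rewrite ler_pM2r ?subr_gt0 //; apply: le_trans (fM c Sc cc).
  by have /andP[] := fitv Sc Sd Sc cc.
exists (L * (t - a)) => _ [H [Ha HM] <-].
have := HM a t L Sa St ta; rewrite Ha subr0; apply => s Ss ast.
by have /andP[] := fitv Sa St Ss ast.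
Qed.

Lemma upper_integral_left : F a = 0.
Proof.
rewrite /F /upper_integral.
have [[_ [H Hd _]] _] := has_sup_dominated ts_itv_left.
rewrite (_ : [set _ | _ in _] = [set 0]) ?sup1 //.
by apply/seteqP; split=> [_ [G [Ga _] <-]//|_ ->]; exists H => //; case: Hd.
Qed.

Lemma upper_integral_sup_dominated : sup_dominated f F.
Proof.
split; first exact: upper_integral_left.
move=> c d M Sc Sd cd fM; rewrite lerBlDr.
apply: ge_sup; first by case: (has_sup_dominated Sd).
move=> _ [H Hf <-]; have Hc : H c <= F c.
  by apply: ub_le_sup; [case: (has_sup_dominated Sc)|exists H].
by have := Hf.2 c d M Sc Sd cd fM; lra.
Qed.

(** Maximality.  On [c, d] the increments of the upper integral F are replaced by
those of the line of slope m, and the part of F beyond d is translated to keep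
the function in one piece.  As m <= f on [c, d), the new function G has the
defining property of F, so that F d >= G d = F c + m (d - c). *)
Lemma upper_integral_ge c d m : S c -> S d -> c <= d ->
  (forall t, S t -> c <= t < d -> m <= f t) -> m * (d - c) <= F d - F c.
Proof.
move=> Sc Sd cd fm.
pose G t := if t <= c then F t else if t <= d then F c + m * (t - c)
  else F t + (F c + m * (d - c) - F d).
have [Fa FM] := upper_integral_sup_dominated.
have [ac _] := ts_itv_bounds Sc; have [_ db] := ts_itv_bounds Sd.
have G1 t : t <= c -> G t = F t by rewrite /G => ->.
have G2 t : c <= t <= d -> G t = F c + m * (t - c).
  rewrite /G => /andP[ct ->]; case: ifPn => // tc.
  have -> : t = c by lra.
  lra.
have G3 t : d <= t -> G t = F t + (F c + m * (d - c) - F d).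
  rewrite /G => dt; case: ifPn => tc; last first.
    by case: ifPn => // td; rewrite (_ : t = d); lra.
  rewrite (_ : t = c); [rewrite (_ : d = c); lra|lra].
(* the bound on the increments of G adds up along consecutive intervals, so it
   suffices to have it on both sides of c and of d *)
pose P u v := forall M, S u -> S v -> u <= v ->
  (forall t, S t -> u <= t < v -> f t <= M) -> G v - G u <= M * (v - u).
have trP x u v : S x -> u <= x -> x <= v -> P u x -> P x v -> P u v.
  move=> Sx ux xv Pux Pxv M Su Sv uv fM.
  have h1 : G x - G u <= M * (x - u).
    by apply: Pux => // t St ht; apply: fM => //; lra.
  have h2 : G v - G x <= M * (v - x).
    by apply: Pxv => // t St ht; apply: fM => //; lra.
  lra.
have P1 u v : v <= c -> P u v.
  by move=> vc M Su Sv uv fM; rewrite !G1 //; [exact: FM|lra].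
have P2 u v : c <= u -> v <= d -> P u v.
  move=> cu vd M Su Sv uv fM; rewrite !G2; [|lra|lra].
  have -> : F c + m * (v - c) - (F c + m * (u - c)) = m * (v - u) by lra.
  move: uv; rewrite le_eqVlt => /predU1P[->|uv]; first by rewrite subrr !mulr0.
  rewrite ler_pM2r ?subr_gt0 //.
  (* m <= M, as both bound the value of f at u, a point of [u, v) *)
  by apply: le_trans (fm u Su _) (fM u Su _); lra.
have P3 u v : d <= u -> P u v.
  move=> du M Su Sv uv fM; rewrite !G3 //; last lra.
  by have := FM u v M Su Sv uv fM; lra.
have P12 u v : v <= d -> P u v.
  move=> vd; have [vc|cv] := leP v c; first exact: P1.
  have [cu|uc] := leP c u; first exact: P2.
  by apply: (trP c) => //; [lra|lra|exact: P1|exact: P2].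
have Gdom : sup_dominated f G.
  split; first by rewrite G1.
  move=> u v M; have [vd|dv] := leP v d; first exact: P12.
  have [du|ud] := leP d u; first exact: P3.
  by apply: (trP d) => //; [lra|lra|exact: P12|exact: P3].
have : G d <= F d.
  by apply: ub_le_sup; [case: (has_sup_dominated Sd)|exists G].
by rewrite G2 ?cd ?lexx //; lra.
Qed.

(** At a right-scattered t, the value f t is both the least and the greatest value
of f on the points of [t, sigma t), which is only t, and the Lipschitz bound L
handles the points to the left of t.  At a right-dense t, the oscillation of f
near t bounds the error from both sides. *)
Lemma upper_integral_delta_antiderivative :
  (forall t, K t -> sigma S t = t -> f s @[s --> within K (nbhs t)] --> f t) ->
  delta_antiderivative T a b f F.
Proof.
move=> fc t Kt e e0; have St := ts_itvk_sub Kt.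
have [Su tu] := ts_itv_sigma St; have [_ FM] := upper_integral_sup_dominated.
have [uE|uN] := eqVneq (sigma S t) t; last first.
  have {}tu : t < sigma S t by rewrite lt_neqAle eq_sym uN.
  have tb : t < b by apply: lt_le_trans tu _; case: (ts_itv_bounds Su).
  have [_ _ umin] := sigmaP St tb.
  have only s : S s -> t <= s < sigma S t -> s = t.
    move=> Ss /andP[ts su]; apply/eqP; rewrite eq_le ts andbT leNgt.
    by apply/negP => /(umin s Ss); rewrite leNgt su.
  have Fu : F (sigma S t) - F t = f t * (sigma S t - t).
    apply/eqP; rewrite eq_le FM ?upper_integral_ge //; try exact: ltW.
      by move=> s Ss /(only s Ss) ->.
    by move=> s Ss /(only s Ss) ->.
  have := fL Kt; rewrite ler_norml => /andP[fl fu].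
  have L1 : 0 < 2 * L + 1 by lra.
  (* for s < t the error is at most 2 L (t - s), to be compared with
     e (sigma t - t) <= e |sigma t - s| *)
  apply/near_within_distP.
  exists (Num.min (sigma S t - t) (e * (sigma S t - t) / (2 * L + 1))).
    by rewrite lt_min subr_gt0 tu divr_gt0 // mulr_gt0 // subr_gt0.
  move=> s Ss; rewrite lt_min => /andP[ts1 ts2].
  have st : s <= t.
    rewrite leNgt; apply/negP => ts; have := umin s Ss ts.
    by move: ts1; rewrite ltr0_norm ?subr_lt0 //; lra.
  rewrite ltr_pdivlMr // ger0_norm ?subr_ge0 // in ts2.
  have h1 : F t - F s <= L * (t - s).
    by apply: FM => // r Sr hr; have /andP[] := fitv Ss St Sr hr.
  have h2 : - L * (t - s) <= F t - F s.
    by apply: upper_integral_ge => // r Sr hr; have /andP[] := fitv Ss St Sr hr.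
  have h3 : f t * (t - s) <= L * (t - s) by rewrite ler_wpM2r ?subr_ge0.
  have h4 : - L * (t - s) <= f t * (t - s) by rewrite ler_wpM2r ?subr_ge0.
  have h5 : e * (sigma S t - t) <= e * `|sigma S t - s|.
    by rewrite ler_pM2l // ger0_norm; lra.
  by apply: le_trans h5; rewrite ler_norml; apply/andP; split; lra.
have /cvgrPdist_lt/(_ e e0)/near_within_distP[r r0 H] := fc t Kt uE.
apply/near_within_distP; exists r => // s Ss tsr; rewrite uE.
have close c d x : S c -> S d -> S x -> `|t - c| < r -> `|t - d| < r ->
    c <= x < d -> f t - e <= f x <= f t + e.
  move=> Sc Sd Sx; rewrite !ltr_norml => tc td cxd.
  have [_ db] := ts_itv_bounds Sd.
  have Kx : K x by apply: ts_itvk_lt => //; lra.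
  have xr : `|t - x| < r by rewrite ltr_norml; lra.
  by have := H x Kx xr; rewrite ltr_norml; lra.
have tt : `|t - t| < r by rewrite subrr normr0.
have [st|ts] := leP s t.
  have h1 : F t - F s <= (f t + e) * (t - s).
    by apply: FM => // x Sx hx; have /andP[] := close s t x Ss St Sx tsr tt hx.
  have h2 : (f t - e) * (t - s) <= F t - F s.
    apply: upper_integral_ge => // x Sx hx.
    by have /andP[] := close s t x Ss St Sx tsr tt hx.
  by rewrite (@ger0_norm _ (t - s)) ?subr_ge0 // ler_norml; lra.
have h1 : F s - F t <= (f t + e) * (s - t).
  apply: FM => //; first exact: ltW.
  by move=> x Sx hx; have /andP[] := close t s x St Ss Sx tt tsr hx.
have h2 : (f t - e) * (s - t) <= F s - F t.
  apply: upper_integral_ge => //; first exact: ltW.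
  by move=> x Sx hx; have /andP[] := close t s x St Ss Sx tt tsr hx.
by rewrite (@ltr0_norm _ (t - s)) ?subr_lt0 // ler_norml; lra.
Qed.

End UpperIntegral.

(** * Boundedness of rd-continuous functions *)

(** On either side of x, the function has a limit along K if the points of S
accumulate at x from that side, and otherwise there are no points of K close to
x on that side. *)
Lemma rd_continuous_locally_bounded f x :
  rd_continuous S K f -> S x ->
  exists2 r, 0 < r &
    exists M, forall s, K s -> `|x - s| < r -> `|f s| <= M.
Proof.
move=> frd Sx.
have bnd l s : `|l - f s| < 1 -> `|f s| <= `|l| + 1.
  move=> h; have := ler_normB l (l - f s); rewrite subKr; lra.
have [Kx|nKx] := pselect (K x); last first.
  have [_] := ts_itv_bounds Sx; rewrite le_eqVlt => /predU1P[xb|/(ts_itvk_lt Sx)//].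
  rewrite xb in nKx *; have [r r0 H] := ts_itvk_right_isolated nKx.
  exists r => //; exists 0 => s Ks bs.
  by have sb := H s (ts_itvk_sub Ks) bs; rewrite sb in Ks.
have [r r0 [M HM]] : exists2 r, 0 < r &
    exists M, forall s, K s -> `|x - s| < r -> x < s -> `|f s| <= M.
  have [xE|xN] := eqVneq (sigma S x) x.
    have /cvgrPdist_lt/(_ 1 ltr01)/near_within_distP[r r0 H] := (frd x Kx).1 xE.
    by exists r => //; exists (`|f x| + 1) => s Ks xs _; apply/bnd/H.
  have [Su xu] := ts_itv_sigma Sx; have [_ ub] := ts_itv_bounds Su.
  have {}xu : x < sigma S x by rewrite lt_neqAle eq_sym xN.
  have [_ _ umin] := sigmaP Sx (lt_le_trans xu ub).
  exists (sigma S x - x); first by rewrite subr_gt0.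
  exists 0 => s Ks + xs; have := umin s (ts_itvk_sub Ks) xs.
  by rewrite ltr0_norm ?subr_lt0 //; lra.
have [r' r'0 [M' HM']] : exists2 r, 0 < r &
    exists M, forall s, K s -> `|x - s| < r -> s < x -> `|f s| <= M.
  have [xE|xN] := eqVneq (rho S x) x.
    have [l /cvgrPdist_lt/(_ 1 ltr01)] := (frd x Kx).2 xE.
    rewrite near_withinE => /near_within_distP[r' r'0 H].
    exists r' => //; exists (`|l| + 1) => s Ks xs sx; apply: bnd.
    exact: (H s sx xs Ks).
  have [[s0 Ss0 s0x]|none] := pselect (exists2 s, S s & s < x); last first.
    exists 1 => //; exists 0 => s Ks _ sx; exfalso; apply: none.
    by exists s => //; exact: ts_itvk_sub.
  move: xN; rewrite /rho; case: asboolP => [_|n]; last first.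
    by exfalso; apply: n; exists s0.
  set E := [set s | S s /\ s < x] => xN.
  have hE : has_ubound E by exists x => s [_ /ltW].
  have Ex : sup E < x.
    by rewrite lt_neqAle xN ge_sup //; [exists s0|move=> s [_ /ltW]].
  exists (x - sup E); first by rewrite subr_gt0.
  exists 0 => s Ks + sx.
  have : s <= sup E by apply: ub_le_sup => //; split=> //; exact: ts_itvk_sub.
  by rewrite gtr0_norm ?subr_gt0 //; lra.
exists (Num.min r r'); first by rewrite lt_min r0.
exists (Num.max `|f x| (Num.max M M')) => s Ks; rewrite lt_min => /andP[h h'].
rewrite !le_max; have [sx|xs|->] := ltgtP s x.
- by rewrite HM' ?orbT.
- by rewrite HM ?orbT.
- by rewrite lexx.
Qed.

Lemma rd_continuous_bounded f :
  rd_continuous S K f -> exists L, forall t, K t -> `|f t| <= L.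
Proof.
move=> frd.
have /compact_near_coveringP cov := compact_ts_itv.
have : \forall M \near +oo, S `<=` [set x | K x -> `|f x| <= M].
  apply: cov => x Sx.
  have [r r0 [M HM]] := rd_continuous_locally_bounded frd Sx.
  near=> x' M' => /= Kx'.
  have xx' : `|x - x'| < r by near: x'; apply/nbhs_ballP; exists r.
  have MM' : M <= M' by near: M'; apply: nbhs_pinfty_ge; rewrite num_real.
  exact: le_trans (HM x' Kx' xx') MM'.
move=> /filter_ex[L HL]; exists L => t Kt; exact: HL (ts_itvk_sub Kt) Kt.
Unshelve. all: by end_near. Qed.

Lemma rd_continuous_ext f g :
  (forall t, K t -> f t = g t) -> rd_continuous S K f -> rd_continuous S K g.
Proof.
move=> fg frd t Kt; split=> [tE|tE].
  rewrite -fg //; apply: cvg_trans ((frd t Kt).1 tE); apply: near_eq_cvg.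
  by apply/near_within_distP; exists 1 => // s Ks _; exact: fg.
have [l fl] := (frd t Kt).2 tE; exists l; apply: cvg_trans fl.
apply: near_eq_cvg; rewrite near_withinE; apply/near_within_distP.
by exists 1 => // s _ _; exact: fg.
Qed.

Lemma delta_integral_increment f :
  (exists F, delta_antiderivative T a b f F) ->
  exists2 F, delta_antiderivative T a b f F &
    forall c d, delta_integral T a b f c d = F d - F c.
Proof. by move=> fF; eexists; [exact: (xgetPex (fun=> 0) fF)|]. Qed.

End TimeScaleInterval.

(** * The function x ln x *)

Section Entropy.
Variable R : realType.
Implicit Types u c : R.

Lemma ln_ge_1Binv u : 0 < u -> 1 - u^-1 <= ln u.
Proof.
move=> u0; have ui0 : 0 < u^-1 by rewrite invr_gt0.
have h : -1 < u^-1 - 1 by lra.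
by have := le_ln1Dx h; rewrite subrKC lnV ?posrE //; lra.
Qed.

Lemma xlnx_tangent u c : 0 < u -> 0 < c ->
  c * ln c + (ln c + 1) * (u - c) <= u * ln u.
Proof.
move=> u0 c0; have uc0 : 0 < u / c by rewrite divr_gt0.
have := ln_ge_1Binv uc0; rewrite invf_div ln_div ?posrE // => h.
have := ler_wpM2l (ltW u0) h.
rewrite mulrBr mulr1 mulrCA divff ?gt_eqF // mulr1; lra.
Qed.

Lemma xlnx_bounds u : 0 < u -> u - 1 <= u * ln u <= u * (u - 1).
Proof.
move=> u0; apply/andP; split.
  have := xlnx_tangent u0 ltr01; rewrite ln1; lra.
have h : -1 < u - 1 by lra.
by rewrite ler_pM2l //; have := le_ln1Dx h; rewrite subrKC.
Qed.

End Entropy.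

(** * Minimization of the entropy functional *)

Theorem theorem86 (R : realType) (T : set R) (a b B : R) (phi : R -> R) :
  time_scale T -> T a -> T b -> a < b ->
  (forall t, ts_itvk T a b t -> 0 < phi t) ->
  rd_continuous (ts_itv T a b) (ts_itvk T a b) phi ->
  let C := (B + delta_integral T a b phi a b) / (b - a) in
  (forall t, ts_itvk T a b t -> phi t < C) ->
  let Fmin := (b - a) * C * ln C in
  (forall y : R -> R, admissible T a b B y -> Fmin <= entropy_functional T a b phi y) /\
  (forall y : R -> R,
     (forall t, ts_itv T a b t ->
        y t = C * (t - a) - delta_integral T a b phi a t) ->
     admissible T a b B y /\ entropy_functional T a b phi y = Fmin).
Proof.
move=> [_ cT] Ta Tb ab phi0 phird C phiC Fmin.
have bCa : b - a != 0 by rewrite subr_eq0 gt_eqF.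
have [L phiL] := rd_continuous_bounded cT Ta Tb ab phird.
have [Phi dPhi intphi] := delta_integral_increment
  (ex_intro _ _ (upper_integral_delta_antiderivative cT Ta Tb ab phiL
    (fun t Kt => (phird t Kt).1))).
have CE : C * (b - a) = B + (Phi b - Phi a) by rewrite /C divfK // intphi.
have Ka : ts_itvk T a b a by apply: ts_itvk_lt => //; exact: ts_itv_left.
have C0 : 0 < C by apply: lt_trans (phiC a Ka); exact: phi0.
split=> [y [[yd yrd] y0 ya yb]|y yE].
  have [M yM] := rd_continuous_bounded cT Ta Tb ab yrd.
  rewrite /entropy_functional; set yD := delta_derive _ y in y0 yrd yM *.
  pose u t := phi t + yD t.
  have u0 t : ts_itvk T a b t -> 0 < u t.
    by move=> Kt; rewrite addr_gt0 ?phi0 ?y0.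
  have uM t : ts_itvk T a b t -> u t <= L + M.
    by move=> Kt; have := phiL t Kt; have := yM t Kt; rewrite !ler_norml /u; lra.
  have [G dG ->] : exists2 G,
      delta_antiderivative T a b (fun t => u t * ln (u t)) G &
      forall c d, delta_integral T a b (fun t => u t * ln (u t)) c d = G d - G c.
    apply: delta_integral_increment; eexists.
    apply: (@upper_integral_delta_antiderivative _ _ _ _ cT Ta Tb ab _
      (1 + (L + M) * (L + M))).
      move=> t Kt; have := xlnx_bounds (u0 t Kt); have := u0 t Kt.
      have := uM t Kt; rewrite ler_norml; nra.
    move=> t Kt tE; have uc : u s @[s --> within (ts_itvk T a b) (nbhs t)] --> u t.
      by apply: cvgD; [exact: (phird t Kt).1|exact: (yrd t Kt).1].
    apply: cvgM => //; apply: continuous_cvg uc; exact/continuous_ln/u0.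
  (* an antiderivative of the tangent line, whose increment is C ln C (b - a) *)
  have dH : delta_antiderivative T a b
      (fun t => C * ln C + (ln C + 1) * (u t - C))
      (fun t => (ln C + 1) * (Phi t + y t) + (- C * t + 0)).
    move=> t Kt; rewrite (_ : _ + _ = (ln C + 1) * (phi t + yD t) + - C); last first.
      by rewrite /u; lra.
    apply: is_delta_deriveD; last exact: is_delta_derive_affine.
    apply: is_delta_deriveZ; apply: is_delta_deriveD; first exact: dPhi.
    by apply: is_delta_derive_delta_derive; exact: yd.
  have := delta_antiderivative_le cT Ta Tb ab dH dG.
  move=> /(_ _); rewrite ya yb => h.
  have {}h := h (fun t Kt => xlnx_tangent (u0 t Kt) C0).
  apply: le_trans h; rewrite /Fmin (mulrC _ C) CE.
  nra.
have {}yE t : ts_itv T a b t -> y t = C * (t - a) - (Phi t - Phi a).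
  by move=> St; rewrite yE // intphi.
have yd t : ts_itvk T a b t -> is_delta_derive (ts_itv T a b) y t (C - phi t).
  move=> Kt; have St := ts_itvk_sub Kt.
  apply: (@is_delta_derive_ext _ _
      (fun s => -1 * Phi s + (C * s + (Phi a - C * a)))).
  - by move=> s Ss; rewrite yE //; lra.
  - by case: (ts_itv_sigma cT Tb ab St).
  rewrite (_ : C - phi t = -1 * phi t + C); last lra.
  apply: is_delta_deriveD; last exact: is_delta_derive_affine.
  by apply: is_delta_deriveZ; exact: dPhi.
have yDE t : ts_itvk T a b t -> delta_derive (ts_itv T a b) y t = C - phi t.
  by move=> Kt; apply: (delta_deriveE Ta Tb ab Kt); exact: yd.
split.
  split.
  - split; first by move=> t Kt; exists (C - phi t); exact: yd.
    apply: (@rd_continuous_ext _ _ _ _ (fun t => C - phi t)) => [t /yDE -> //|].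
    move=> t Kt; split=> tE.
      by apply: cvgB; [exact: cvg_cst|exact: (phird t Kt).1].
    have [l phil] := (phird t Kt).2 tE; exists (C - l).
    by apply: cvgB => //; exact: cvg_cst.
  - by move=> t Kt; rewrite yDE // subr_gt0 phiC.
  - by rewrite yE; [lra|exact: ts_itv_left].
  - by rewrite yE ?CE; [lra|exact: ts_itv_right].
rewrite /entropy_functional.
set g := fun t => _.
have gE t : ts_itvk T a b t -> g t = C * ln C.
  by move=> Kt; rewrite /g yDE // addrC subrK.
have dlin : delta_antiderivative T a b g (fun t => C * ln C * t + 0).
  by move=> t Kt; rewrite gE //; exact: is_delta_derive_affine.
have [G dG ->] := delta_integral_increment (ex_intro _ _ dlin).
have h1 := delta_antiderivative_le cT Ta Tb ab dlin dG (fun t _ => lexx (g t)).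
have h2 := delta_antiderivative_le cT Ta Tb ab dG dlin (fun t _ => lexx (g t)).
by rewrite /Fmin; lra.
Qed.
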